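(* Let $(\mathfrak{A}_q,[\cdot,\cdot]_q,\alpha_q)$ be the $q$-deformed Heisenberg-Virasoro superalgebra of Hom-type. If $\varphi$ is an odd $q$-derivation of $\mathfrak{A}_q$ of degree $s\neq -1$, then it is an inner derivation; more precisely, $$(\mathcal{Q}\mathrm{Der}\,\mathfrak{A}_q)_{1,s}=\langle \mathrm{ad}_{G_s}+\mathrm{ad}_{T_s}\rangle,$$ where $(\mathcal{Q}\mathrm{Der}\,\mathfrak{A}_q)_{1,s}$ is the space of odd $q$-derivations of degree $s$.
   Context: Let $q\in\mathbb{C}\setminus\{0,1\}$ and $\{n\}=\frac{1-q^n}{1-q}$ for $n\in\mathbb{Z}$. $\mathfrak{A}_q$ is the complex superspace with basis $\{L_m,I_m\mid m\in\mathbb{Z}\}$ of parity $0$ and $\{G_m,T_m\mid m\in\mathbb{Z}\}$ of parity $1$, with super-skew-symmetric bracket ($[x,y]_q=-(-1)^{|x||y|}[y,x]_q$) determined by $[L_m,L_n]_q=(\{m\}-\{n\})L_{m+n}$, $[L_m,I_n]_q=-\{n\}I_{m+n}$, $[L_m,G_n]_q=(\{m\}-\{n+1\})G_{m+n}$, $[I_m,G_n]_q=\{m\}T_{m+n}$, $[L_m,T_n]_q=-\{n+1\}T_{m+n}$, and $[I_m,I_n]_q=[I_m,T_n]_q=[T_m,G_n]_q=[T_m,T_n]_q=[G_m,G_n]_q=0$; the twist is the even linear map $\alpha_q(L_n)=(1+q^n)L_n$, $\alpha_q(I_n)=(1+q^n)I_n$, $\alpha_q(G_n)=(1+q^{n+1})G_n$,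 $\alpha_q(T_n)=(1+q^{n+1})T_n$. An odd $q$-derivation of degree $s\in\mathbb{Z}$ is an odd linear map $\varphi:\mathfrak{A}_q\to\mathfrak{A}_q$ that maps $\mathrm{span}(L_n,I_n)$ into $\mathrm{span}(G_{n+s},T_{n+s})$ and $\mathrm{span}(G_n,T_n)$ into $\mathrm{span}(L_{n+s},I_{n+s})$ for all $n$, and satisfies, for all homogeneous $x,y$, $$\varphi([x,y]_q)=\frac{1}{1+q^{s+1}}\Big([\varphi(x),\alpha_q(y)]_q+(-1)^{|x|}[\alpha_q(x),\varphi(y)]_q\Big).$$ For a homogeneous $a\in\mathfrak{A}_q$, $\mathrm{ad}_a$ is the map $x\mapsto[a,x]_q$, called an inner $q$-derivation. $\langle\cdot\rangle$ denotes linear span.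
   Formalization: Assumes 1+q^{s+1}≠0 (else the q-derivation rule is undefined) and {s+1}≠0 (if q^{s+1}=1, L_n↦T_{n+s} is a non-inner q-derivation); ⟨ad_{G_s}+ad_{T_s}⟩ is taken as the span of both ad_{G_s} and ad_{T_s}, since the line through their sum misses ad_{G_s}. *)

(* Defs.v *)
From HB Require Import structures.
From mathcomp Require Import all_boot all_order all_algebra.
From mathcomp Require Import finmap monalg.
From mathcomp Require Import boolp classical_sets functions reals complex.

Set Implicit Arguments.
Unset Strict Implicit.
Unset Printing Implicit Defensive.

Import GRing.Theory.
Local Open Scope ring_scope.
Local Open Scope classical_set_scope.

Section LinearSpan.
Context (K : pzRingType) (V : lmodType K).

Definition lin_span (X : set V) : set V :=
  [set v | exists (n : nat) (c : 'I_n -> K) (u : 'I_n -> V),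
     (forall i, X (u i)) /\ v = \sum_(i < n) c i *: u i].

End LinearSpan.

Inductive gen := gL of int | gI of int | gG of int | gT of int.

Definition gen_code (x : gen) : (bool * bool) * int :=
  match x with
  | gL m => ((false, false), m)
  | gI m => ((false, true), m)
  | gG m => ((true, false), m)
  | gT m => ((true, true), m)
  end.

Definition gen_decode (c : (bool * bool) * int) : gen :=
  match c with
  | ((false, false), m) => gL m
  | ((false, true), m) => gI m
  | ((true, false), m) => gG m
  | ((true, true), m) => gT m
  end.

Lemma gen_codeK : cancel gen_code gen_decode.
Proof. by case. Qed.

HB.instance Definition _ := Choice.copy gen (can_type gen_codeK).

(* [true] is the odd parity. *)
Definition gen_parity (x : gen) : bool :=
  match x with gL _ | gI _ => false | gG _ | gT _ => true end.

(* Finitely supported functions from [gen] to the complex numbers: the free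
   vector space with basis [<< x >>], [x : gen]. *)
Notation hv_super R := {malg R[i][gen]}.

Section HeisenbergVirasoro.
Context (R : realType).
Local Notation C := R[i].
Local Notation A := (hv_super R).

Definition Lb (m : int) : A := << gL m >>.
Definition Ib (m : int) : A := << gI m >>.
Definition Gb (m : int) : A := << gG m >>.
Definition Tb (m : int) : A := << gT m >>.

Definition homogeneous (p : bool) (x : A) : Prop :=
  forall g, g \in msupp x -> gen_parity g = p.

Context (q : C).

Definition qnum (n : int) : C := (1 - q ^ n) / (1 - q).

Definition bracket_gen (x y : gen) : A :=
  match x, y with
  | gL m, gL n => (qnum m - qnum n) *: Lb (m + n)
  | gL m, gI n => - qnum n *: Ib (m + n)
  | gI m, gL n => qnum m *: Ib (m + n)
  | gL m, gG n => (qnum m - qnum (n + 1)) *: Gb (m + n)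
  | gG m, gL n => (qnum (m + 1) - qnum n) *: Gb (m + n)
  | gI m, gG n => qnum m *: Tb (m + n)
  | gG m, gI n => - qnum n *: Tb (m + n)
  | gL m, gT n => - qnum (n + 1) *: Tb (m + n)
  | gT m, gL n => qnum (m + 1) *: Tb (m + n)
  | _, _ => 0
  end.

Lemma bracket_gen_superskew x y :
  bracket_gen x y =
  - ((-1) ^+ (gen_parity x && gen_parity y) *: bracket_gen y x).
Proof.
case: x => m; case: y => n;
  rewrite /= ?expr0 ?scale1r ?scaler0 ?oppr0 // (addrC n m) -[RHS]scaleNr;
  by rewrite ?opprB ?opprK.
Qed.

Definition bracket (x y : A) : A :=
  \sum_(g <- msupp x) \sum_(h <- msupp y) (x@_g * y@_h) *: bracket_gen g h.

Lemma bracket_basis g h : bracket << g >> << h >> = bracket_gen g h.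
Proof. by rewrite /bracket !msuppU !oner_eq0 !big_seq_fset1 !mcoeffUU mulr1 scale1r. Qed.

Definition twist_coef (x : gen) : C :=
  match x with
  | gL n | gI n => 1 + q ^ n
  | gG n | gT n => 1 + q ^ (n + 1)
  end.

Definition twist (x : A) : A :=
  \sum_(g <- msupp x) (x@_g * twist_coef g) *: << g >>.

Definition ad (a x : A) : A := bracket a x.

Definition inner : set (A -> A) :=
  [set phi | exists p a, homogeneous p a /\ phi = ad a].

Definition odd_qder (s : int) : set (A -> A) :=
  [set phi |
   [/\ linear phi,
       forall p x, homogeneous p x -> homogeneous (~~ p) (phi x),
       forall n, phi @` lin_span [set Lb n; Ib n]
                   `<=` lin_span [set Gb (n + s); Tb (n + s)],
       forall n, phi @` lin_span [set Gb n; Tb n]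
                   `<=` lin_span [set Lb (n + s); Ib (n + s)]
     & forall p p' x y, homogeneous p x -> homogeneous p' y ->
         phi (bracket x y) =
         (1 + q ^ (s + 1))^-1 *:
           (bracket (phi x) (twist y)
            + (-1) ^+ p *: bracket (twist x) (phi y))]].

End HeisenbergVirasoro.

(* Main.v *)
Require Import Defs.
From HB Require Import structures.
From mathcomp Require Import all_boot all_order all_algebra.
From mathcomp Require Import finmap monalg.
From mathcomp Require Import boolp classical_sets functions reals complex.
From mathcomp Require Import ring.

Set Implicit Arguments.
Unset Strict Implicit.
Unset Printing Implicit Defensive.

Import GRing.Theory.
Local Open Scope ring_scope.
Local Open Scope classical_set_scope.

(** The parity-shifted copies G_n and T_n behave like L_(n+1) and I_(n+1)
    multiplied by an odd variable of square zero, and the bracket satisfies the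
    multiplicative super Hom-Jacobi identity

      [alpha x, [y, z]] = [[x, y], alpha z] + (-1)^(|x||y|) [alpha y, [x, z]].

    Since alpha multiplies G_s and T_s by 1 + q^(s+1), dividing by this number
    shows that ad_(G_s) and ad_(T_s) are odd q-derivations of degree s; this is
    [hom_jacobi] and [ad_odd_qder], and it gives one inclusion.

    For the converse, ad_(G_s) and ad_(T_s) send L_0 to {s+1} G_s and
    {s+1} T_s.  As {s+1} is nonzero, a combination of them can be subtracted
    from an odd q-derivation phi of degree s so that the difference kills L_0.
    It remains to see that an odd q-derivation phi with phi(L_0) = 0 vanishes
    ([qder_eq0]).

    The operator ad_(L_0) is diagonal in the given basis, so applying phi to
    [L_0, x] for a basis vector x gives a scalar times phi(x) equal to zero
    ([qder_weight0]).  Write k = s + 1 and t = q^k; the two hypotheses on the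
    degree say exactly that t is neither -1 nor 1.

    - For x = L_n or I_n the scalar is (1 + q^n){k}.  It can vanish only when
      q^n = -1; in that case it does not vanish in degree n + k, and the bracket
      of x with L_k forces phi(x) = 0 ([qder_even_gen_eq0]).

    - For x = G_n the scalar is (1 - t + q^(n+1) K)/(1 - q) for a constant K, so
      all n with phi(G_n) nonzero share the same value of q^(n+1).  If there
      were such an n, then phi would vanish on G_(n+k) and G_(n+2k), and
      bracketing these with L_(-k) and L_(-2k) to come back to G_n would give
      q^(n+1) t^2 = 1 and q^(n+1) t^4 = 1, hence t^2 = 1 ([qder_G_gen_eq0]).
      This argument covers roots of unity q as well.

    - Finally T_n = [I_1, G_(n-1)], so phi(T_n) = 0 ([qder_T_gen_eq0]). *)

(** * Linear maps, scalars and spans of two vectors *)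

Section LinearMaps.
Context (K : pzRingType) (U V : lmodType K) (f : U -> V).
Context (lf : linear f).

Lemma linear_map0 : f 0 = 0.
Proof. by have := lf (-1) 0 0; rewrite scaler0 addr0 scaleN1r addNr. Qed.

Lemma linear_mapZ c x : f (c *: x) = c *: f x.
Proof. by rewrite -[c *: x]addr0 lf linear_map0 addr0. Qed.

Lemma linear_map2 a b x y : f (a *: x + b *: y) = a *: f x + b *: f y.
Proof. by rewrite lf linear_mapZ. Qed.

End LinearMaps.

Lemma linear_map_scaleZ (K : pzRingType) (V : lmodType K) (f : V -> V) k c x :
  linear f -> k *: f (c *: x) = (k * c) *: f x.
Proof. by move=> lf; rewrite (linear_mapZ lf) scalerA. Qed.

Section LinSpan.
Context (K : pzRingType) (V : lmodType K).

Lemma lin_span_gen (X : set V) u : X u -> lin_span X u.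
Proof.
move=> Xu; exists 1%N, (fun=> 1), (fun=> u); split=> //.
by rewrite big_ord1 scale1r.
Qed.

Lemma lin_span2P (u v w : V) :
  lin_span [set u; v] w <-> exists a b, w = a *: u + b *: v.
Proof.
split=> [[n [c [x [xuv ->]]]]|[a [b ->]]].
  elim: n c x xuv => [|n IHn] c x xuv.
    by exists 0, 0; rewrite big_ord0 !scale0r addr0.
  rewrite big_ord_recl.
  have [a [b ->]] := IHn (c \o lift ord0) (x \o lift ord0)
    (fun i => xuv (lift ord0 i)).
  case: (xuv ord0) => ->.
    by exists (c ord0 + a), b; rewrite scalerDl addrA.
  by exists a, (c ord0 + b); rewrite scalerDl addrCA.
exists 2%N, (fun i => if i == ord0 then a else b),
  (fun i => if i == ord0 then u else v); split.
  by move=> i; case: ifP => _; [left|right].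
by rewrite big_ord_recl big_ord1.
Qed.

Lemma lin_span2_l (c : K) (u v : V) : lin_span [set u; v] (c *: u).
Proof. by apply/lin_span2P; exists c, 0; rewrite scale0r addr0. Qed.

Lemma lin_span2_r (c : K) (u v : V) : lin_span [set u; v] (c *: v).
Proof. by apply/lin_span2P; exists 0, c; rewrite scale0r add0r. Qed.

Lemma lin_span2_0 (u v : V) : lin_span [set u; v] 0.
Proof. by rewrite -(scale0r u); apply: lin_span2_l. Qed.

Lemma lin_span2_lin (c : K) (u v x y : V) :
  lin_span [set u; v] x -> lin_span [set u; v] y ->
  lin_span [set u; v] (c *: x + y).
Proof.
move=> /lin_span2P[a [b ->]] /lin_span2P[a' [b' ->]].
apply/lin_span2P; exists (c * a + a'), (c * b + b').
by rewrite scalerDr !scalerDl !scalerA addrACA.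
Qed.

Lemma lin_image_span2 (f : V -> V) (u v u' v' : V) : linear f ->
  lin_span [set u'; v'] (f u) -> lin_span [set u'; v'] (f v) ->
  f @` lin_span [set u; v] `<=` lin_span [set u'; v'].
Proof.
move=> fl /lin_span2P[a [b fu]] /lin_span2P[c [d fv]].
move=> _ [_ /lin_span2P[e [e' ->]] <-].
apply/lin_span2P; exists (e * a + e' * c), (e * b + e' * d).
by rewrite (linear_map2 fl) fu fv !scalerDr !scalerDl !scalerA addrACA.
Qed.

End LinSpan.

Section Scaling.
Context (K : fieldType) (V : lmodType K).

Lemma scaler_neq0_eq0 (a : K) (x : V) : a != 0 -> a *: x = 0 -> x = 0.
Proof. by move=> a0 /eqP; rewrite scaler_eq0 (negPf a0) => /eqP. Qed.

Lemma scale_eigen_eq0 (a b w : K) (x : V) :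
  a - b * w != 0 -> a *: x = b *: (w *: x) -> x = 0.
Proof.
move=> abw E; apply: (scaler_neq0_eq0 abw).
by rewrite scalerBl E scalerA subrr.
Qed.

Lemma scale_comb (a b c : K) (u v : V) :
  a *: (c *: u) + b *: (c *: v) = c *: (a *: u + b *: v).
Proof. by rewrite scalerDr !scalerA !(mulrC c). Qed.

Lemma scale_pair (a b c d : K) (u v : V) :
  a *: (c *: u) + b *: (d *: v) = (a * c) *: u + (b * d) *: v.
Proof. by rewrite !scalerA. Qed.

Lemma comb_cancel (a b k : K) (u v : V) : k != 0 ->
  - (a / k) *: (k *: u) + (- (b / k) *: (k *: v) + (a *: u + b *: v)) = 0.
Proof.
move=> k0; rewrite !scalerA !mulNr !divfK // !scaleNr.
by rewrite addrCA addKr addNr.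
Qed.

Lemma comb_solve (a b : K) (u v w : V) :
  - a *: u + (- b *: v + w) = 0 -> w = a *: u + b *: v.
Proof.
rewrite !scaleNr => /eqP; rewrite addrC addr_eq0 opprK => /eqP <-.
by rewrite addrC addNKr.
Qed.
End Scaling.

(** Commutativity is a hypothesis here and below, instead of a part of the
    structure of [K], so that [V] unifies with [{malg K[T]}], whose module
    structure sees its scalars only as a nonzero ring. *)
Section Combinations.
Context (K : nzRingType) (V : lmodType K) (mulC : commutative (@GRing.mul K)).

Lemma comb_jacobi (c e : K) (u u' v v' : V) :
  c *: (u + e *: v) + (u' + e *: v') = (c *: u + u') + e *: (c *: v + v').
Proof. by rewrite !scalerDr !scalerA (mulC e) addrACA. Qed.

Lemma comb_linear (c : K) (f g : V -> V) :
  linear f -> linear g -> linear (fun x => c *: f x + g x).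
Proof.
move=> lf lg a x y; rewrite lf lg !scalerDr !scalerA (mulC a) -!addrA.
by congr (_ + _); rewrite addrCA.
Qed.

Lemma comb_leibniz (c k e : K) (u u' v v' : V) :
  c *: (k *: (u + e *: u')) + k *: (v + e *: v') =
  k *: ((c *: u + v) + e *: (c *: u' + v')).
Proof.
rewrite !scalerDr !scalerA addrACA; congr (_ + _ + (_ + _)).
  by rewrite (mulC c).
by rewrite -!mulrA (mulC c) -!mulrA.
Qed.
End Combinations.

(** * The Hom-Jacobi identity as a trilinear condition *)

Section HomJacobi.
Context (K : nzRingType) (V : lmodType K) (mulC : commutative (@GRing.mul K)).
Context (b : V -> V -> V) (t : V -> V).
Context (bl : forall y, linear (b ^~ y)) (br : forall x, linear (b x)).
Context (tl : linear t).

(** The multiplicative Hom-Jacobi identity for the bracket [b] and the twist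
    [t], in Leibniz form; [e] is the sign (-1)^(|x||y|). *)
Definition hom_jacobi_eq (e : K) x y z :=
  b (t x) (b y z) = b (b x y) (t z) + e *: b (t y) (b x z).

Let bDl c x x' y : b (c *: x + x') y = c *: b x y + b x' y.
Proof. exact: (bl y). Qed.

Let bDr c x y y' : b x (c *: y + y') = c *: b x y + b x y'.
Proof. exact: br. Qed.

Let b0l y : b 0 y = 0. Proof. exact: (linear_map0 (bl y)). Qed.

Let b0r x : b x 0 = 0. Proof. exact: (linear_map0 (br x)). Qed.

Let bZl c x y : b (c *: x) y = c *: b x y.
Proof. exact: (linear_mapZ (bl y)). Qed.

Let bZr c x y : b x (c *: y) = c *: b x y.
Proof. exact: (linear_mapZ (br x)). Qed.

Context (e : K).
Local Notation J := (hom_jacobi_eq e).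

Lemma hom_jacobi_lin_l c x x' y z : J x y z -> J x' y z -> J (c *: x + x') y z.
Proof. by move=> hx hx'; rewrite /J tl !(bDl, bDr) hx hx' comb_jacobi. Qed.

Lemma hom_jacobi_lin_m c x y y' z : J x y z -> J x y' z -> J x (c *: y + y') z.
Proof. by move=> hy hy'; rewrite /J tl !(bDl, bDr) hy hy' comb_jacobi. Qed.

Lemma hom_jacobi_lin_r c x y z z' : J x y z -> J x y z' -> J x y (c *: z + z').
Proof. by move=> hz hz'; rewrite /J tl !(bDl, bDr) hz hz' comb_jacobi. Qed.

Lemma hom_jacobi_0l y z : J 0 y z.
Proof. by rewrite /J (linear_map0 tl) !b0l b0r scaler0 addr0. Qed.

Lemma hom_jacobi_0m x z : J x 0 z.
Proof. by rewrite /J (linear_map0 tl) b0l !b0r !b0l scaler0 addr0. Qed.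

Lemma hom_jacobi_0r x y : J x y 0.
Proof. by rewrite /J (linear_map0 tl) !b0r scaler0 addr0. Qed.

(** On eigenvectors of the twist, such as the basis vectors, the identity is an
    equality between iterated brackets of these vectors. *)
Lemma hom_jacobi_eigen p q r x y z :
  t x = p *: x -> t y = q *: y -> t z = r *: z ->
  p *: b x (b y z) = r *: b (b x y) z + e *: (q *: b y (b x z)) -> J x y z.
Proof. by rewrite /J => -> -> -> E; rewrite 2!bZl bZr. Qed.

End HomJacobi.

(** * Bilinearity of the bracket and parity *)

Section LinearExtension.
Context (K : pzRingType) (T : choiceType) (V : lmodType K).

Lemma malg_sum_scale (d : {fset T}) (f : T -> V) (x : {malg K[T]}) :
  (msupp x `<=` d)%fset ->
  \sum_(g <- msupp x) x@_g *: f g = \sum_(g <- d) x@_g *: f g.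
Proof.
move=> xd; apply: big_fset_incl => // g _ /mcoeff_outdom ->.
by rewrite scale0r.
Qed.
End LinearExtension.

Section Bracket.
Context (R : realType) (q : R[i]).
Local Notation C := R[i].
Local Notation A := (hv_super R).

Definition linear_ext (V : lmodType C) (f : gen -> V) (x : A) : V :=
  \sum_(g <- msupp x) x@_g *: f g.

Lemma linear_ext_linear (V : lmodType C) (f : gen -> V) : linear (linear_ext f).
Proof.
(* The supports of the three vectors differ: sum over a common one. *)
move=> c x y; pose d := (msupp x `|` msupp y)%fset.
have dx : (msupp x `<=` d)%fset by rewrite fsubsetUl.
have dy : (msupp y `<=` d)%fset by rewrite fsubsetUr.
have dxy : (msupp (c *: x + y) `<=` d)%fset.
  apply: fsubset_trans (msuppD_le _ _) _.
  by rewrite fsubUset dy (fsubset_trans (msuppZ_le _ _)).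
rewrite /linear_ext (malg_sum_scale _ dx) (malg_sum_scale _ dy).
rewrite (malg_sum_scale _ dxy).
rewrite scaler_sumr -big_split; apply: eq_bigr => g _ /=.
by rewrite mcoeffD mcoeffZ scalerDl scalerA.
Qed.

HB.instance Definition _ (V : lmodType C) (f : gen -> V) :=
  GRing.isLinear.Build C A V *:%R (linear_ext f) (linear_ext_linear f).

Lemma linear_ext_gen (V : lmodType C) (f : gen -> V) g :
  linear_ext f << g >> = f g.
Proof.
by rewrite /linear_ext msuppU oner_eq0 big_seq_fset1 mcoeffUU scale1r.
Qed.

Lemma bracketE x y :
  bracket q x y = linear_ext (fun g => linear_ext (bracket_gen q g) y) x.
Proof.
apply: eq_bigr => g _; rewrite scaler_sumr; apply: eq_bigr => h _.
by rewrite scalerA.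
Qed.

Lemma twistE x :
  twist q x = linear_ext (fun g => twist_coef q g *: (<< g >> : A)) x.
Proof. by apply: eq_bigr => g _; rewrite scalerA. Qed.

Lemma bracket_linear_l y : linear (bracket q ^~ y).
Proof. by move=> c x x'; rewrite !bracketE linearP. Qed.

Lemma bracket_linear_r x : linear (bracket q x).
Proof.
have E z : bracket q x z =
    \sum_(g <- msupp x) x@_g *: linear_ext (bracket_gen q g) z := bracketE x z.
move=> c y y'; rewrite !E scaler_sumr -big_split.
apply: eq_bigr => g _ /=.
by rewrite linearP scalerDr !scalerA mulrC.
Qed.

Lemma twist_linear : linear (twist q).
Proof. by move=> c x x'; rewrite !twistE linearP. Qed.

HB.instance Definition _ x :=
  GRing.isLinear.Build C A A *:%R (bracket q x) (bracket_linear_r x).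

Lemma bracketDl x x' y : bracket q (x + x') y = bracket q x y + bracket q x' y.
Proof. by rewrite !bracketE linearD. Qed.

Lemma bracketZl c x y : bracket q (c *: x) y = c *: bracket q x y.
Proof. by rewrite !bracketE linearZ. Qed.

Lemma bracket0l y : bracket q 0 y = 0.
Proof. by rewrite !bracketE linear0. Qed.

Lemma bracketDr x y y' : bracket q x (y + y') = bracket q x y + bracket q x y'.
Proof. exact: linearD. Qed.

Lemma bracketZr c x y : bracket q x (c *: y) = c *: bracket q x y.
Proof. exact: linearZ. Qed.

Lemma bracket0r x : bracket q x 0 = 0.
Proof. exact: linear0. Qed.

Lemma twist_gen g : twist q << g >> = twist_coef q g *: << g >>.
Proof. by rewrite twistE linear_ext_gen. Qed.

(** Linear induction restricted to the span of the basis vectors satisfying [D];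
    with [D] a parity it is induction on homogeneous vectors. *)
Lemma malg_lin_ind (D : gen -> Prop) (P : A -> Prop) :
  P 0 -> (forall g, D g -> P << g >>) ->
  (forall c x y, P x -> P y -> P (c *: x + y)) ->
  forall x, (forall g, g \in msupp x -> D g) -> P x.
Proof.
move=> P0 Pg Plin x xD.
have -> : x = \sum_(g <- msupp x) x@_g *: (<< g >> : A).
  rewrite [LHS]monalgE; apply: eq_bigr => g _.
  by apply/malgP => h; rewrite mcoeffZ !mcoeffU mulrnAr mulr1.
rewrite big_seq; elim/big_rec: _ => // g y /xD/Pg; exact: Plin.
Qed.

Lemma homogeneous_gen g : homogeneous (gen_parity g) (<< g >> : A).
Proof. by move=> h; rewrite msuppU oner_eq0 in_fset1 => /eqP ->. Qed.

Lemma homogeneous0 p : homogeneous p (0 : A).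
Proof. by move=> g; rewrite msupp0 in_fset0. Qed.

Lemma homogeneous_lin p c (x y : A) :
  homogeneous p x -> homogeneous p y -> homogeneous p (c *: x + y).
Proof.
move=> hx hy g /(fsubsetP (msuppD_le _ _)); rewrite in_fsetU.
by case/orP => [/(fsubsetP (msuppZ_le _ _))/hx|/hy].
Qed.

Lemma homogeneousZ p c (x : A) : homogeneous p x -> homogeneous p (c *: x).
Proof.
move=> hx; rewrite -[_ *: _]addr0; apply: homogeneous_lin => //.
exact: homogeneous0.
Qed.

(** For each choice of types both sides lie on the line of one basis vector, and
    the coefficients agree by a rational identity in q^l, q^m, q^n and q. *)
Lemma hom_jacobi_gen (hq0 : q != 0) (hq1 : q != 1) (x y z : gen) :
  twist_coef q x *: bracket q << x >> (bracket_gen q y z) =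
  twist_coef q z *: bracket q (bracket_gen q x y) << z >>
  + (-1) ^+ (gen_parity x && gen_parity y) *:
    (twist_coef q y *: bracket q << y >> (bracket_gen q x z)).
Proof.
have nz : 1 - q != 0 by rewrite subr_eq0 eq_sym.
case: x => l; case: y => m; case: z => n; rewrite /= /Lb /Ib /Gb /Tb.
all: rewrite ?(bracket0l, bracketZl, bracketZr, linear0, bracket_basis) /=.
all: rewrite ?expr0 ?scale1r.
all: rewrite ?(scaler0, addr0, add0r); try reflexivity.
all: rewrite ?(addrCA m l) ?addrA.
all: rewrite !scalerA -?scalerDl; congr (_ *: _).
all: rewrite /qnum !expfzDr // ?expr1z.
all: move: (q ^ l) (q ^ m) (q ^ n) => a b c.
all: field.
all: exact: nz.
Qed.

End Bracket.

(** * The inner q-derivations ad_(G_s) and ad_(T_s) *)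

Section Derivations.
Context (R : realType) (q : R[i]).
Local Notation C := R[i].
Local Notation A := (hv_super R).
Context (hq0 : q != 0) (hq1 : q != 1).

(** Both sides are trilinear, so the identity is reduced to basis vectors, where
    it is the computation [hom_jacobi_gen]. *)
Lemma hom_jacobi p p' (x y z : A) : homogeneous p x -> homogeneous p' y ->
  bracket q (twist q x) (bracket q y z) =
  bracket q (bracket q x y) (twist q z)
  + (-1) ^+ (p && p') *: bracket q (twist q y) (bracket q x z).
Proof.
set e := (-1) ^+ (p && p').
rewrite -/(hom_jacobi_eq (bracket q) (twist q) e x y z).
have mC (a b : C) : a * b = b * a := mulrC a b.
have bl := bracket_linear_l q; have br := @bracket_linear_r _ q.
have tl := twist_linear q.
pose J := hom_jacobi_eq (bracket q) (twist q) e.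
move=> hx hy; apply: (malg_lin_ind (P := fun x => J x y z) _ _ _ hx).
- exact (hom_jacobi_0l bl br tl e y z).
- move=> g gp; apply: (malg_lin_ind (P := fun y => J _ y z) _ _ _ hy).
  + exact (hom_jacobi_0m bl br tl e _ z).
  + move=> h hp; apply: (malg_lin_ind (P := fun z => J _ _ z) _ _ _
      (fun k (_ : k \in msupp z) => I)).
    * exact (hom_jacobi_0r br tl e _ _).
    * move=> k _; apply: (hom_jacobi_eigen bl br
        (twist_gen q g) (twist_gen q h) (twist_gen q k)).
      rewrite !bracket_basis /e -gp -hp; exact: hom_jacobi_gen.
    * move=> c u v Ju Jv; exact (hom_jacobi_lin_r mC br tl c Ju Jv).
  + move=> c u v Ju Jv; exact (hom_jacobi_lin_m mC bl br tl c Ju Jv).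
- move=> c u v Ju Jv; exact (hom_jacobi_lin_l mC bl br tl c Ju Jv).
Qed.

Lemma bracket_gen_homogeneous g h :
  homogeneous (gen_parity g (+) gen_parity h) (bracket_gen q g h).
Proof.
case: g => m; case: h => n; rewrite /= /Lb /Ib /Gb /Tb.
all: lazymatch goal with
  | |- homogeneous _ 0 => apply: homogeneous0
  | |- _ => apply: homogeneousZ; apply: homogeneous_gen end.
Qed.

Context (s : int) (hden : 1 + q ^ (s + 1) != 0).

(** Both G_s and T_s are eigenvectors of the twist for 1 + q^(s+1), so the
    Hom-Jacobi identity with first argument G_s or T_s is the q-derivation rule
    multiplied by this eigenvalue. *)
Lemma ad_odd_qder z : z = gG s \/ z = gT s -> odd_qder q s (ad q << z >>).
Proof.
move=> zs; have zodd : gen_parity z by case: zs => ->.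
have ztw : twist_coef q z = 1 + q ^ (s + 1) by case: zs => ->.
split.
- exact: bracket_linear_r.
- move=> p; apply: (malg_lin_ind (D := fun g => gen_parity g = p)).
  + by rewrite /ad linear0; apply: homogeneous0.
  + move=> g <-; rewrite /ad bracket_basis -addTb -zodd.
    exact: bracket_gen_homogeneous.
  + move=> c x y hx hy; rewrite /ad bracketDr bracketZr.
    exact (@homogeneous_lin _ _ c _ _ hx hy).
- move=> n; apply: lin_image_span2; first exact: bracket_linear_r.
  + by rewrite /ad bracket_basis; case: zs => -> /=; rewrite (addrC n);
      [apply: lin_span2_l | apply: lin_span2_r].
  + by rewrite /ad bracket_basis; case: zs => -> /=; rewrite (addrC n);
      [apply: lin_span2_r | apply: lin_span2_0].
- move=> n; apply: lin_image_span2; first exact: bracket_linear_r.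
  + by rewrite /ad bracket_basis; case: zs => -> /=; apply: lin_span2_0.
  + by rewrite /ad bracket_basis; case: zs => -> /=; apply: lin_span2_0.
- move=> p p' x y hx hy; rewrite /ad.
  have := hom_jacobi y (@homogeneous_gen _ z) hx.
  rewrite twist_gen ztw bracketZl zodd /= => /(canRL (scalerK _)); exact.
Qed.

Lemma odd_qder0 : odd_qder q s 0.
Proof.
split.
- by move=> c x y; change (0 = c *: 0 + 0 :> A); rewrite scaler0 addr0.
- by move=> p x _; apply: homogeneous0.
- by move=> n _ [x _ <-]; apply: lin_span2_0.
- by move=> n _ [x _ <-]; apply: lin_span2_0.
- move=> p p' x y _ _.
  change (0 = (1 + q ^ (s + 1))^-1 *: (bracket q 0 (twist q y)
                + (-1) ^+ p *: bracket q (twist q x) 0)).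
  by rewrite bracket0l bracket0r scaler0 addr0 scaler0.
Qed.

Lemma odd_qder_lin c phi psi :
  odd_qder q s phi -> odd_qder q s psi -> odd_qder q s (c *: phi + psi).
Proof.
move=> [l1 p1 e1 o1 d1] [l2 p2 e2 o2 d2].
have E x : (c *: phi + psi) x = c *: phi x + psi x by [].
split.
- exact (comb_linear (fun a b => mulrC a b) c l1 l2).
- move=> p x hx; rewrite E.
  exact (@homogeneous_lin _ _ c _ _ (p1 _ _ hx) (p2 _ _ hx)).
- move=> n _ [x hx <-]; rewrite E.
  by apply: lin_span2_lin; [apply: e1|apply: e2]; exists x.
- move=> n _ [x hx <-]; rewrite E.
  by apply: lin_span2_lin; [apply: o1|apply: o2]; exists x.
- move=> p p' x y hx hy; rewrite !E (d1 _ _ _ _ hx hy) (d2 _ _ _ _ hx hy).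
  rewrite bracketDl bracketZl bracketDr bracketZr.
  exact: (comb_leibniz (fun a b => mulrC a b)).
Qed.

Lemma odd_qderZ c phi : odd_qder q s phi -> odd_qder q s (c *: phi).
Proof.
move=> dphi.
have E : c *: phi + 0 = c *: phi.
  by apply/funext => x; exact (addr0 (c *: phi x)).
exact (eq_ind _ (odd_qder q s) (odd_qder_lin c dphi odd_qder0) _ E).
Qed.

End Derivations.

(** * Rigidity: an odd q-derivation killing L_0 is zero *)

Section Rigidity.
Context (R : realType) (q : R[i]).
Local Notation C := R[i].
Local Notation A := (hv_super R).
Context (hq0 : q != 0) (hq1 : q != 1).

Lemma qnum0 : qnum q 0 = 0.
Proof. by rewrite /qnum expr0z subrr mul0r. Qed.

Lemma subq1_neq0 : 1 - q != 0.
Proof. by rewrite subr_eq0 eq_sym. Qed.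

Lemma qnum_eq m n : (qnum q m == qnum q n) = (q ^ m == q ^ n).
Proof.
have u : (1 - q)^-1 != 0 by rewrite invr_eq0 subq1_neq0.
rewrite /qnum (inj_eq (mulIf u)) -subr_eq0 opprB addrC addrA subrK.
by rewrite subr_eq0 eq_sym.
Qed.

Lemma qnum_eq0 n : (qnum q n == 0) = (q ^ n == 1).
Proof. by rewrite -qnum0 qnum_eq expr0z. Qed.

Lemma bracket_L0_even j x :
  lin_span [set Lb R j; Ib R j] x -> bracket q (Lb R 0) x = - qnum q j *: x.
Proof.
move=> /lin_span2P[a [b ->]].
rewrite (linear_map2 (@bracket_linear_r _ q _)) /Lb /Ib 2!bracket_basis /=.
rewrite qnum0 sub0r add0r /Lb /Ib.
move: (<< gL j >> : A) (<< gI j >> : A) => u v.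
exact: scale_comb.
Qed.

Lemma bracket_L0_odd j x :
  lin_span [set Gb R j; Tb R j] x ->
  bracket q (Lb R 0) x = - qnum q (j + 1) *: x.
Proof.
move=> /lin_span2P[a [b ->]].
rewrite (linear_map2 (@bracket_linear_r _ q _)) /Lb /Gb /Tb 2!bracket_basis /=.
rewrite qnum0 sub0r add0r /Gb /Tb.
move: (<< gG j >> : A) (<< gT j >> : A) => u v.
exact: scale_comb.
Qed.

Lemma mcoeff_comb (a b : C) (x y : A) g :
  (a *: x + b *: y)@_g = a * x@_g + b * y@_g.
Proof. rewrite mcoeffD; congr (_ + _); exact: mcoeffZ. Qed.

Lemma GT_free i (a b : C) : a *: Gb R i + b *: Tb R i = 0 -> a = 0 /\ b = 0.
Proof.
move=> E; split.
  have := congr1 (mcoeff (gG i)) E.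
  by rewrite mcoeff_comb /Gb /Tb 2!mcoeffU eqxx mulr0 mulr1 addr0 mcoeff0.
have := congr1 (mcoeff (gT i)) E.
by rewrite mcoeff_comb /Gb /Tb 2!mcoeffU eqxx mulr0 mulr1 add0r mcoeff0.
Qed.

Lemma GT_free_scaled i (a b c d : C) :
  a *: (c *: Gb R i) + b *: (d *: Tb R i) = 0 -> a * c = 0 /\ b * d = 0.
Proof.
move=> E; apply: (@GT_free i).
exact: etrans (esym (scale_pair a b c d (Gb R i) (Tb R i))) E.
Qed.

Context (s : int) (phi : A -> A).
Context (hden : 1 + q ^ (s + 1) != 0) (hnum : qnum q (s + 1) != 0).
Context (hphi : odd_qder q s phi).

Lemma qder_gen g h :
  (1 + q ^ (s + 1)) *: phi (bracket_gen q g h) =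
  twist_coef q h *: bracket q (phi << g >>) << h >>
  + (-1) ^+ gen_parity g *: (twist_coef q g *: bracket q << g >> (phi << h >>)).
Proof.
have [_ _ _ _] := hphi.
move=> /(_ _ _ _ _ (@homogeneous_gen _ g) (@homogeneous_gen _ h)).
rewrite bracket_basis !twist_gen (bracketZr q (twist_coef q h)).
by rewrite (bracketZl q (twist_coef q g)) => ->; apply: (scalerKV hden).
Qed.

(** Once phi kills L_m, it commutes with ad_(L_m) up to the scalars
    1 + q^(s+1) and 1 + q^m. *)
Lemma qder_L m h h' c :
  phi << gL m >> = 0 -> bracket_gen q (gL m) h = c *: << h' >> ->
  ((1 + q ^ (s + 1)) * c) *: phi << h' >> =
  (1 + q ^ m) *: bracket q << gL m >> (phi << h >>).
Proof.
move=> Lm E; have := qder_gen (gL m) h.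
rewrite E Lm bracket0l scaler0 add0r /= expr0 scale1r => <-.
have [lphi _ _ _ _] := hphi.
rewrite (linear_map_scaleZ _ _ _ lphi).
reflexivity.
Qed.

Context (phiL0 : phi << gL 0 >> = 0).

(** Here [c] and [w] are the ad_(L_0)-weights of the basis vector [h] and of its
    image. *)
Lemma qder_weight0 h c w :
  bracket_gen q (gL 0) h = c *: << h >> ->
  bracket q << gL 0 >> (phi << h >>) = w *: phi << h >> ->
  (1 + q ^ (s + 1)) * c - (1 + q ^ 0) * w != 0 -> phi << h >> = 0.
Proof.
move=> E W nz; have := qder_L phiL0 E; rewrite W.
exact: (scale_eigen_eq0 nz).
Qed.

(** The weight equation reads (1 + q^n){s+1} phi(x) = 0.  When q^n = -1 it is
    void, but it still kills L_(s+1) and the vector of index n + s + 1, because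
    1 + q^(n+s+1) = 1 - q^(s+1) is nonzero; so phi(x) commutes with L_(s+1), and
    on the span of G_(n+s) and T_(n+s) this bracket is injective. *)
Lemma qder_even_gen_eq0 Y n : Y = gL \/ Y = gI -> phi << Y n >> = 0.
Proof.
have qn m : q ^ m != 0 by rewrite expfz_neq0.
have nz := subq1_neq0.
move=> HY.
(* The case where the weight equation determines the image. *)
have genericY Z m : Z = gL \/ Z = gI -> 1 + q ^ m != 0 -> phi << Z m >> = 0.
  move=> HZ wm; apply: (@qder_weight0 _ (- qnum q m) (- qnum q (m + s + 1))).
  - by case: HZ => ->; rewrite /= ?qnum0 ?sub0r add0r; reflexivity.
  - apply: bracket_L0_odd; have [_ _ /(_ m) im _ _] := hphi.
    apply: im; exists << Z m >> => //.
    by case: HZ => ->; apply: lin_span_gen; [left|right].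
  - have -> : (1 + q ^ (s + 1)) * - qnum q m
        - (1 + q ^ 0) * - qnum q (m + s + 1) = (1 + q ^ m) * qnum q (s + 1).
      rewrite /qnum -addrA expr0z (expfzDr m) //.
      by move: (q ^ m) (q ^ (s + 1)) => x y; field; exact: nz.
    exact: mulf_neq0.
have [wn|/genericY] := eqVneq (1 + q ^ n) 0; last exact.
have qnN : q ^ n = -1 by apply/eqP; rewrite -addr_eq0 addrC wn.
have wkn : 1 + q ^ (s + 1 + n) != 0.
  rewrite expfzDr // qnN mulrN1; apply: contraNneq hnum => E.
  by rewrite qnum_eq0 eq_sym -subr_eq0 E.
have Lk : phi << gL (s + 1) >> = 0 by apply: genericY => //; left.
have Ykn : phi << Y (s + 1 + n) >> = 0 by exact: genericY.
have [a [b Eab]] : exists a b,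
    phi << Y n >> = a *: Gb R (n + s) + b *: Tb R (n + s).
  apply/lin_span2P; have [_ _ /(_ n) im _ _] := hphi.
  apply: im; exists << Y n >> => //.
  by case: HY => ->; apply: lin_span_gen; [left|right].
have [c Ec] : exists c,
    bracket_gen q (gL (s + 1)) (Y n) = c *: << Y (s + 1 + n) >>.
  by case: HY => -> /=; eexists; reflexivity.
have := qder_L Lk Ec; rewrite Ykn scaler0 => /esym/(scaler_neq0_eq0 hden).
rewrite Eab (linear_map2 (@bracket_linear_r _ q _)) /Gb /Tb 2!bracket_basis /=.
move=> /GT_free_scaled[/eqP + /eqP].
have t0 := qn (s + 1).
have -> : n + s + 1 = n + (s + 1) by rewrite addrA.
rewrite !mulf_eq0 subr_eq0 qnum_eq oppr_eq0 qnum_eq0 (expfzDr n) // qnN mulN1r.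
rewrite (eq_sym (q ^ (s + 1)) (- _)) Num.Theory.eqNr (negPf t0) orbF => /eqP a0.
rewrite eqr_oppLR -addr_eq0 addrC (negPf hden) orbF => /eqP b0.
by rewrite a0 b0 2!scale0r addr0.
Qed.

(** Vanishing at one index propagates to another one unless the structure
    constant of the bracket with L_m vanishes.  The weight equation gives two
    indices where phi vanishes, n + (s+1) and n + 2(s+1); a nonzero phi(G_n)
    makes both structure constants vanish, and then t^2 = 1. *)
Lemma qder_G_gen_eq0 n : phi << gG n >> = 0.
Proof.
have qn m : q ^ m != 0 by rewrite expfz_neq0.
have nz := subq1_neq0.
set t := q ^ (s + 1).
have t0 : t != 0 := qn _.
have t1 : t != 1 by rewrite -qnum_eq0.
have tt : t ^+ 2 != 1.
  by rewrite sqrf_eq1 negb_or t1 -addr_eq0 addrC hden.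
pose K := 1 + t - 2 * (t / q ^+ 2).
(* The weight equation restricts the support of phi on the G_m. *)
have supp m : phi << gG m >> != 0 -> 1 - t + q ^ (m + 1) * K = 0.
  apply: contra_neq_eq => nz0.
  apply: (@qder_weight0 _ (- qnum q (m + 1)) (- qnum q (m + s))).
  - by rewrite /= qnum0 sub0r add0r; reflexivity.
  - apply: bracket_L0_even; have [_ _ _ /(_ m) im _] := hphi.
    apply: im; exists << gG m >> => //; by apply: lin_span_gen; left.
  - have -> : (1 + q ^ (s + 1)) * - qnum q (m + 1)
        - (1 + q ^ 0) * - qnum q (m + s) = (1 - t + q ^ (m + 1) * K) / (1 - q).
      have -> : m + s = m + 1 + (s + 1) - 2 by ring.
      rewrite /qnum expr0z (expfzDr _ (- 2)) // (expfzDr (m + 1)) //.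
      rewrite -[q ^ (- 2)]/((q ^+ 2)^-1) /K -/t.
      move: (q ^ (m + 1)) => y; field; by rewrite nz hq0.
    by apply: mulf_neq0; rewrite ?invr_eq0.
(* If phi kills G_p but not G_(m+p), then [L_m, G_p] has to be zero. *)
have shift m p : phi << gG p >> = 0 -> phi << gG (m + p) >> != 0 ->
    q ^ m = q ^ (p + 1).
  move=> p0; apply: contra_neq_eq => ne.
  have Lm : phi << gL m >> = 0 by apply: qder_even_gen_eq0; left.
  have E : bracket_gen q (gL m) (gG p) =
    (qnum q m - qnum q (p + 1)) *: << gG (m + p) >> by [].
  have := qder_L Lm E; rewrite p0 bracket0r scaler0.
  by apply: scaler_neq0_eq0; rewrite mulf_neq0 // subr_eq0 qnum_eq.
apply/eqP; apply: contraT => n0; have E0 := supp _ n0.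
(* As t differs from 1, the support equation at n excludes the one at n + k. *)
have E1 : phi << gG (n + (s + 1)) >> = 0.
  apply/eqP; apply: contraT => /supp.
  rewrite (addrAC n) (expfzDr (n + 1)) // -/t => E.
  have : (1 - t) * (1 - t) = 0.
    apply: etrans (_ : (1 - t + q ^ (n + 1) * t * K)
        - t * (1 - t + q ^ (n + 1) * K) = _).
      by ring.
    by rewrite E E0 mulr0 subrr.
  by move/eqP; rewrite mulf_eq0 orbb subr_eq0 eq_sym (negPf t1).
(* Likewise at n + 2k, since the square of t differs from 1. *)
have E2 : phi << gG (n + (s + 1 + (s + 1))) >> = 0.
  apply/eqP; apply: contraT => /supp.
  rewrite (addrAC n) (expfzDr (n + 1)) // (expfzDr (s + 1)) // -/t => E.
  have : (1 - t) * (1 - t ^+ 2) = 0.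
    apply: etrans (_ : (1 - t + q ^ (n + 1) * (t * t) * K)
        - t ^+ 2 * (1 - t + q ^ (n + 1) * K) = _).
      by ring.
    by rewrite E E0 mulr0 subrr.
  by move/eqP; rewrite mulf_eq0 !subr_eq0 !(eq_sym 1) (negPf t1) (negPf tt).
have := shift (- (s + 1)) _ E1; rewrite addrCA addNr addr0 => /(_ n0).
have := shift (- (s + 1 + (s + 1))) _ E2; rewrite addrCA addNr addr0 => /(_ n0).
rewrite (addrAC n (s + 1) 1) (addrAC n (s + 1 + (s + 1)) 1).
rewrite (expfzDr (n + 1) (s + 1)) // (expfzDr (n + 1)) //.
rewrite -2!invr_expz (expfzDr (s + 1)) // -/t.
move: (q ^ (n + 1)) => y F2 F1; case/eqP: tt.
have G1 : y * t ^+ 2 = 1.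
  by rewrite expr2 mulrA -F1 mulVf.
have G2 : y * t ^+ 2 * t ^+ 2 = 1.
  by rewrite expr2 -[y * _ * _]mulrA mulrA -F2 mulVf // mulf_neq0.
by rewrite -G2 G1 mul1r.
Qed.

Lemma qder_T_gen_eq0 n : phi << gT n >> = 0.
Proof.
have [lphi _ _ _ _] := hphi.
have := qder_gen (gI 1) (gG (n - 1)).
rewrite qder_G_gen_eq0 qder_even_gen_eq0; last by right.
rewrite bracket0l bracket0r 3!scaler0 addr0 /= (addrC 1 (n - 1)) subrK.
rewrite (linear_map_scaleZ _ _ _ lphi); apply: scaler_neq0_eq0.
apply: mulf_neq0 => //; rewrite qnum_eq0; exact: hq1.
Qed.

Lemma qder_eq0 x : phi x = 0.
Proof.
have [lphi _ _ _ _] := hphi.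
apply: (malg_lin_ind (P := fun x => phi x = 0) _ _ _
  (fun k (_ : k \in msupp x) => I)).
- exact: linear_map0.
- case=> n _; first by apply: qder_even_gen_eq0; left.
  + by apply: qder_even_gen_eq0; right.
  + exact: qder_G_gen_eq0.
  + exact: qder_T_gen_eq0.
- move=> c u v u0 v0; rewrite lphi u0 v0 scaler0 addr0; reflexivity.
Qed.
End Rigidity.

(** * The space of odd q-derivations *)

Lemma ad_G_L0 (R : realType) (q : R[i]) s :
  ad q (Gb R s) (Lb R 0) = qnum q (s + 1) *: Gb R s.
Proof.
by rewrite /ad /Gb /Lb bracket_basis /= qnum0 subr0 addr0; reflexivity.
Qed.

Lemma ad_T_L0 (R : realType) (q : R[i]) s :
  ad q (Tb R s) (Lb R 0) = qnum q (s + 1) *: Tb R s.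
Proof. by rewrite /ad /Tb /Lb bracket_basis /= addr0; reflexivity. Qed.

Theorem proposition3p6 (R : realType) (q : R[i]) (hq0 : q != 0) (hq1 : q != 1)
    (s : int) (hs : s != -1)
    (hden : 1 + q ^ (s + 1) != 0)
    (hnum : qnum q (s + 1) != 0) :
  odd_qder q s `<=` inner q /\
  odd_qder q s = lin_span [set ad q (Gb R s); ad q (Tb R s)].
Proof.
have derG : odd_qder q s (ad q (Gb R s)).
  by apply: (ad_odd_qder hq0 hq1 hden); left.
have derT : odd_qder q s (ad q (Tb R s)).
  by apply: (ad_odd_qder hq0 hq1 hden); right.
have der_comb phi a b : odd_qder q s phi ->
    odd_qder q s (a *: ad q (Gb R s) + (b *: ad q (Tb R s) + phi)).
  by move=> dphi; exact (odd_qder_lin a derG (odd_qder_lin b derT dphi)).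
have der_span phi : odd_qder q s phi ->
    exists a b, phi = a *: ad q (Gb R s) + b *: ad q (Tb R s).
  move=> dphi; have [_ _ /(_ 0) im _ _] := dphi.
  have /lin_span2P[a [b Eab]] :
      lin_span [set Gb R (0 + s); Tb R (0 + s)] (phi (Lb R 0)).
    by apply: im; exists (Lb R 0) => //; apply: lin_span_gen; left.
  rewrite add0r in Eab.
  set k := qnum q (s + 1) in hnum.
  (* These coefficients match the value of phi at L_0. *)
  exists (a / k), (b / k).
  have dpsi := der_comb phi (- (a / k)) (- (b / k)) dphi.
  have psiL0 : (- (a / k) *: ad q (Gb R s)
      + (- (b / k) *: ad q (Tb R s) + phi)) (Lb R 0) = 0.
    apply: etrans (comb_cancel a b (Gb R s) (Tb R s) hnum).
    change (- (a / k) *: ad q (Gb R s) (Lb R 0)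
      + (- (b / k) *: ad q (Tb R s) (Lb R 0) + phi (Lb R 0)) =
      - (a / k) *: (k *: Gb R s)
      + (- (b / k) *: (k *: Tb R s) + (a *: Gb R s + b *: Tb R s))).
    rewrite ad_G_L0 ad_T_L0 Eab; reflexivity.
  have psi0 := qder_eq0 hq0 hq1 hden hnum dpsi psiL0.
  by apply/funext => x; exact (comb_solve (psi0 x)).
split.
  move=> phi /der_span[a [b ->]].
  exists true, (a *: Gb R s + b *: Tb R s); split.
    apply: homogeneous_lin; first exact: (@homogeneous_gen _ (gG s)).
    apply: homogeneousZ; exact: (@homogeneous_gen _ (gT s)).
  apply/funext => x; apply/esym.
  exact (linear_map2 (bracket_linear_l q x) a b (Gb R s) (Tb R s)).
apply/seteqP; split=> phi.
  by move=> /der_span h; apply/lin_span2P.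
move=> /lin_span2P[a [b ->]].
exact (odd_qder_lin a derG (odd_qderZ b derT)).
Qed.
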